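(* Let $p$ be an odd prime and suppose that $H_{4p}$ is a real Hadamard matrix of order $4p$. Then $H_{4p}$ is not of Dita-type.
   Context: A complex Hadamard matrix of order $N$ is an $N\times N$ matrix $H$ with $|H_{i,j}|=1$ and $HH^\ast=NI$; a real Hadamard matrix is one with entries $\pm1$. Two Hadamard matrices $H_1,H_2$ are equivalent if $H_1=D_1P_1H_2P_2D_2$ with $D_1,D_2$ diagonal unitary and $P_1,P_2$ permutation matrices. Dita's construction: if $M=(m_{ij})$ is a complex Hadamard matrix of order $k$ and $N_1,\dots,N_k$ are complex Hadamard matrices of order $n$, then the block matrix $K$ whose $(i,j)$ block is $m_{ij}N_j$ is a complex Hadamard matrix of order $nk$. A complex Hadamard matrix is Dita-type if it is equivalent to a matrix $K$ arising in this way (with $n,k\geq 2$). *)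

(* Defs.v *)
From mathcomp Require Import all_boot all_order all_algebra.
From mathcomp Require Import complex reals.

Set Implicit Arguments.
Unset Strict Implicit.
Unset Printing Implicit Defensive.

Import Order.TTheory GRing.Theory Num.Theory.

Local Open Scope ring_scope.
Local Open Scope sesquilinear_scope.

Section Hadamard.

Variable C : numClosedFieldType.

Definition complex_hadamard N (H : 'M[C]_N) : Prop :=
  (forall i j, `|H i j| = 1) /\ H *m H^t* = N%:R%:M.

Definition real_hadamard N (H : 'M[C]_N) : Prop :=
  complex_hadamard H /\ forall i j, H i j = 1 \/ H i j = -1.

Definition diag_unitary N (D : 'M[C]_N) : Prop :=
  is_diag_mx D /\ D \is unitarymx.

Definition hadamard_equiv N (H1 H2 : 'M[C]_N) : Prop :=
  exists D1 P1 P2 D2 : 'M[C]_N,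
    [/\ diag_unitary D1, diag_unitary D2, is_perm_mx P1, is_perm_mx P2
      & H1 = D1 *m P1 *m H2 *m P2 *m D2].

(* The order of a block matrix is by construction the sum of its block sizes,
   here k copies of n, which is only propositionally equal to n * k. *)
Definition dita_mx n k (M : 'M[C]_k) (B : 'I_k -> 'M[C]_n) :
    'M[C]_(\sum_(i < k) n) :=
  \mxblock_(i < k, j < k) (M i j *: B j).

Definition dita_type N (H : 'M[C]_N) : Prop :=
  exists (n k : nat) (M : 'M[C]_k) (B : 'I_k -> 'M[C]_n)
         (e : (\sum_(i < k) n)%N = N),
    [/\ (2 <= n)%N, (2 <= k)%N, complex_hadamard M,
        forall j, complex_hadamard (B j)
      & hadamard_equiv H (castmx (e, e) (dita_mx M B))].

End Hadamard.

(* Main.v *)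
Require Import Defs.
From mathcomp Require Import all_boot all_order all_algebra all_fingroup.
From mathcomp Require Import complex reals.
From mathcomp Require Import ring zify.

(** In [K], fixing the block position exhibits [B j] (up to rescaling rows and
    columns) as a submatrix of a real Hadamard matrix, and fixing the position
    inside the blocks does the same for [M].  So [n] and [k], like the order of
    any real Hadamard matrix, are at most 2 or multiples of 4, which is
    impossible when [n * k = 4 * p] with [p > 1] odd and [n, k >= 2]. *)

Import Order.TTheory GRing.Theory Num.Theory.

Local Open Scope ring_scope.
Local Open Scope sesquilinear_scope.

(** Rescaling rows by any [u] keeps them orthogonal; the column factors [v] must be unimodular so
    that they cancel in Hermitian products of rows. *)
Definition real_up_to_phases {C : numClosedFieldType} {N : nat}
    (A : 'M[C]_N) : Prop :=
  exists u v : 'I_N -> C, (forall j, `|v j| = 1) /\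
    forall i j, u i * A i j * v j = 1 \/ u i * A i j * v j = -1.

(** The rescaled matrix [s] has real signs as entries and pairwise orthogonal rows; for order at
    least 3, comparing three rows gives divisibility by 4. *)
Lemma complex_hadamard_order {C : numClosedFieldType} {N : nat} (A : 'M[C]_N) :
  complex_hadamard A -> real_up_to_phases A -> (N <= 2)%N \/ (4 %| N)%N.
Proof.
case: N A => [|[|[|N]]] A [_ AA] [u [v [v1 sA]]];
  [by left | by left | by left | right].
pose s i j := u i * A i j * v j.
have sE i j : s i j = 1 \/ s i j = -1 by exact: sA.
have s_conj i j : (s i j)^* = s i j.
  by case: (sE i j) => ->; rewrite ?rmorphN rmorph1.
have s_orth i i' : i != i' -> \sum_j s i j * s i' j = 0.
  move=> ne_ii'.
  have: (A *m A^t*) i i' = 0 by rewrite AA mxE (negPf ne_ii').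
  rewrite mxE => A_orth.
  transitivity (u i * (u i')^* * \sum_j A i j * (A^t*) j i').
    rewrite mulr_sumr; apply: eq_bigr => j _.
    (* Conjugating the real factor [s i' j] turns the sum into a multiple of a Hermitian product of
       rows of [A]. *)
    rewrite -[s i' j]s_conj /s !rmorphM !mxE /=.
    have vv : v j * (v j)^* = 1 by rewrite -normCK v1 expr1n.
    rewrite -[RHS]mulr1 -vv; ring.
  by rewrite A_orth mulr0.
pose r0 : 'I_N.+3 := inord 0; pose r1 : 'I_N.+3 := inord 1.
pose r2 : 'I_N.+3 := inord 2.
have [n01 n02 n12] : [/\ r0 != r1, r0 != r2 & r1 != r2].
  by split; rewrite -val_eqE /= !inordK.
pose b j := (s r0 j == s r1 j) && (s r0 j == s r2 j).
(* Each summand of [\sum_j (s r0 j + s r1 j) * (s r0 j + s r2 j) = N] is 0 or 4. *)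
have sumE : \sum_j (s r0 j + s r1 j) * (s r0 j + s r2 j) = N.+3%:R.
  under eq_bigr => j _ do rewrite mulrDl !mulrDr.
  (* The three cross sums vanish, leaving the sum of the squares of [s r0 j]. *)
  rewrite !big_split /= (s_orth r0 r2) // (s_orth r1 r2) //.
  rewrite (s_orth r1 r0) 1?eq_sym // !addr0.
  rewrite (eq_bigr (fun=> 1)) ?sumr_const ?card_ord // => j _.
  by case: (sE r0 j) => ->; rewrite ?mulrNN mulr1.
have N1 : (1 == -1 :> C) = false.
  by rewrite -subr_eq0 opprK -(natrD _ 1 1) pnatr_eq0.
have N1' : (-1 == 1 :> C) = false by rewrite eq_sym.
have bE j : (s r0 j + s r1 j) * (s r0 j + s r2 j) = (4 * b j)%:R.
  rewrite /b.
  case: (sE r0 j) => ->; case: (sE r1 j) => ->; case: (sE r2 j) => ->;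
    rewrite ?eqxx ?N1 ?N1' /= ?muln1 ?muln0; ring.
move: sumE; under eq_bigr => j _ do rewrite bE.
move/eqP; rewrite -natr_sum eqr_nat -big_distrr /= => /eqP <-.
exact: dvdn_mulr.
Qed.

Lemma diag_unitaryP {C : numClosedFieldType} {N : nat} (D : 'M[C]_N) :
  diag_unitary D -> exists2 d : 'rV[C]_N, D = diag_mx d & forall j, `|d 0 j| = 1.
Proof.
case=> /diag_mxP [d ->] /unitarymxP DD; exists d => // j.
have := congr1 (fun A : 'M_N => A j j) DD.
rewrite mul_diag_mx !mxE eqxx !mulr1n => dd.
by apply/eqP; rewrite -(@pexpr_eq1 _ _ 2) // normCK dd.
Qed.

Lemma hadamard_equiv_real {C : numClosedFieldType} {N : nat} (H K : 'M[C]_N) :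
  real_hadamard H -> hadamard_equiv H K -> real_up_to_phases K.
Proof.
case=> _ H_real [D1] [P1] [P2] [D2] [].
move=> /diag_unitaryP [d1 -> _] /diag_unitaryP [d2 -> d2_norm].
move=> /is_perm_mxP [s ->] /is_perm_mxP [t ->] HE.
(* Entry [(i, j)] of [K] lands in row [s^-1 i] and column [t j] of [H], where it meets these
   phases. *)
exists (fun i => d1 0 ((s^-1)%g i)), (fun j => d2 0 (t j)).
split=> [j | i j]; first exact: d2_norm.
have := H_real ((s^-1)%g i) (t j).
rewrite HE mul_mx_diag mxE -[in perm_mx t](invgK t) -col_permE.
by rewrite -mulmxA -row_permE mul_diag_mx !mxE permK permKV.
Qed.

Lemma dita_mxE {C : numClosedFieldType} {n k : nat} (M : 'M[C]_k)
    (B : 'I_k -> 'M[C]_n) i j a b :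
  dita_mx M B (tagnat.Rank i a) (tagnat.Rank j b) = M i j * B j a b.
Proof.
have := congr1 (fun A : 'M_n => A a b)
  (mxblockK (fun i j => M i j *: B j) i j).
by rewrite !mxE.
Qed.

Lemma dita_mx_real {C : numClosedFieldType} {n k : nat} (M : 'M[C]_k)
    (B : 'I_k -> 'M[C]_n) :
    (0 < n)%N -> complex_hadamard M -> (forall j, complex_hadamard (B j)) ->
    real_up_to_phases (dita_mx M B) ->
  real_up_to_phases M /\ forall j, real_up_to_phases (B j).
Proof.
move=> n_gt0 [M1 _] B_had [u [v [v1 sK]]]; split=> [|j].
  (* At position [(a, a)] of every block, the factor [B j a a] is unimodular and depends on the
     column only, so it joins [v]. *)
  pose a : 'I_n := Ordinal n_gt0.
  exists (fun i => u (tagnat.Rank i a)), (fun j => B j a a * v (tagnat.Rank j a)).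
  split=> [j|i j]; first by rewrite normrM v1 (B_had j).1 mulr1.
  by have := sK (tagnat.Rank i a) (tagnat.Rank j a); rewrite dita_mxE !mulrA.
(* In the diagonal block [(j, j)] the constant [M j j] is absorbed into the row factors. *)
exists (fun a => u (tagnat.Rank j a) * M j j), (fun b => v (tagnat.Rank j b)).
split=> [b|a b]; first exact: v1.
by have := sK (tagnat.Rank j a) (tagnat.Rank j b); rewrite dita_mxE !mulrA.
Qed.

Local Open Scope complex_scope.

Theorem theorem3p2 (R : realType) (p : nat) (H : 'M[R[i]]_(4 * p)%N)
    (p_prime : prime p) (p_odd : odd p) (H_real : real_hadamard H) :
  ~ dita_type H.
Proof.
case=> n [k] [M] [B] [e] [n_ge2 k_ge2 M_had B_had].
have p_gt1 := prime_gt1 p_prime.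
move/(hadamard_equiv_real _ _ H_real) => {H_real}.
have nk : (n * k = 4 * p)%N by rewrite -e sum_nat_const card_ord mulnC.
case: _ / e H => _; rewrite castmx_id.
move/(dita_mx_real _ _ (ltnW n_ge2) M_had B_had) => [M_real B_real].
have k_order := complex_hadamard_order _ M_had M_real.
have n_order := complex_hadamard_order _ (B_had _) (B_real (Ordinal (ltnW k_ge2))).
have k_even : (2 %| k)%N by lia.
(* If [n = 2] then [k = 2 * p], which exceeds 2 and is not a multiple of 4. If [n = m * 4] then the
   even [k] divides the odd [p]. *)
case: n_order => [n_le2 | /dvdnP [m n4]];
  first by (have n2 : n = 2%N by lia); rewrite n2 in nk; lia.
have mk : (m * k = p)%N by lia.
by move: p_odd; rewrite -mk oddM andbC -[odd k]negbK -dvdn2 k_even.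
Qed.
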